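(* Let $\rho \in \left[\frac{17}{25}, \frac{7}{10}\right]$ and $\alpha \in \left[\frac{17}{100}, \frac{23}{100}\right]$ be real numbers. Then $$I(S_2,\rho,\alpha,\alpha) = \alpha^3 + (\rho-\alpha^2)\sqrt{\rho+\alpha^2}.$$
   Context: All graphs are finite and simple. $S_2$ denotes the star with two edges (the path on three vertices). For a graph $G$, $N(S_2,G)$ is the number of (not necessarily induced) subgraphs of $G$ isomorphic to $S_2$, i.e. $N(S_2,G)=\sum_{v\in V(G)}\binom{d_G(v)}{2}$, where $d_G(v)$ is the degree of $v$. For a graph $G$ on $n$ vertices, its $S_2$-density is $\rho(S_2,G) = \frac{N(S_2,G)}{3\binom{n}{3}}$. For $S\subseteq V(G)$ let $\delta_G(S)=\min\{d_G(v): v\in S\}$. For nonnegative integers $n,m,\ell,k$ with $m\le\binom n2$ and $k\ell\le m$, let $\mathcal{G}(n,m,\ell,k)$ be the family of all graphs $G$ on $n$ vertices with exactly $m$ edges that contain an independent set $I$ with $|I|\ge \ell$ and $\delta_G(I)\ge k$. For real numbers $\rho,\alpha,\beta\in[0,1]$ define $$I(S_2,\rho,\alpha,\beta)=\limsup_{n\to\infty}\ \max\left\{\rho(S_2,G): G\in\mathcal{G}\left(n,\left\lfloor\rho\tbinom n2\right\rfloor,\lfloor\alpha n\rfloor,\lfloor\beta n\rfloor\right)\right\}.$$ *)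

(* Defs.v *)
From HB Require Import structures.
From mathcomp Require Import all_boot all_order all_algebra.
From mathcomp Require Import all_classical all_reals all_analysis.

Set Implicit Arguments.
Unset Strict Implicit.
Unset Printing Implicit Defensive.

Import Order.TTheory GRing.Theory Num.Theory.

Local Open Scope ring_scope.

(* A finite simple graph on the vertex type V: a set of two-element subsets
   of V. *)
Record sgraph (V : finType) := SGraph {
  edges :> {set {set V}};
  edges_card2 : [forall e in edges, #|e| == 2%N] }.

HB.instance Definition _ (V : finType) := [isSub for @edges V].
HB.instance Definition _ (V : finType) := [Countable of sgraph V by <:].
HB.instance Definition _ (V : finType) := [Finite of sgraph V by <:].

Section Graphs.
Variable V : finType.
Implicit Types (G : sgraph V) (S : {set V}) (v : V).

Definition incident G v : {set {set V}} := [set e in edges G | v \in e].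

Definition degree G v : nat := #|incident G v|.

Definition independent G S : bool := [forall e in edges G, ~~ (e \subset S)].

(* The neutral element #|V| exceeds every degree, so for nonempty S this is
   the minimum of the degrees in S; it stands for +oo when S is empty. *)
Definition min_degree G S : nat := \big[minn/#|V|]_(v in S) degree G v.

Definition nb_S2 G : nat := \sum_(v : V) 'C(degree G v, 2).

Lemma edge_card G e : e \in edges G -> #|e| = 2%N.
Proof. by move=> eG; have /forall_inP/(_ e eG)/eqP := edges_card2 G. Qed.

Lemma degree_le G v : (degree G v <= #|V|)%N.
Proof.
have sub : incident G v \subset [set [set v; w] | w : V].
  apply/fintype.subsetP => e; rewrite inE => /andP[eG ve].
  have /cards2P[x [y [_ exy]]] : #|e| == 2%N by rewrite (edge_card eG).
  move: ve; rewrite exy !inE => /orP[] /eqP ->.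
    by apply/imsetP; exists y.
  by apply/imsetP; exists x => //; rewrite finset.setUC.
by apply: leq_trans (subset_leq_card sub) _; rewrite leq_imset_card.
Qed.

Lemma leq_min_degree G S k : (k <= #|V|)%N ->
  (k <= min_degree G S)%N = [forall v in S, (k <= degree G v)%N].
Proof.
move=> kV; apply/idP/forall_inP => [kd v vS|kd].
  apply: leq_trans kd _; rewrite /min_degree -big_filter.
  have: v \in [seq w <- index_enum V | w \in S].
    by rewrite mem_filter vS mem_index_enum.
  elim: [seq w <- _ | _] => //= w s IHs; rewrite big_cons inE => /orP[/eqP <-|/IHs le_d].
    exact: geq_minl.
  exact: leq_trans (geq_minr _ _) le_d.
rewrite /min_degree; elim/big_ind: _ => // x y kx ky.
by rewrite leq_min kx ky.
Qed.

(* A copy of the star with two edges is determined by its edge set, a pair of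
   distinct edges of G with a common vertex. *)
Lemma nb_S2E G :
  nb_S2 G = #|[set F : {set {set V}} | [&& F \subset edges G, #|F| == 2%N
               & [exists v, [forall e in F, v \in e]]]]|.
Proof.
have inc (F : {set {set V}}) v : (F \subset incident G v) =
    (F \subset edges G) && [forall e in F, v \in e].
  apply/idP/andP => [/fintype.subsetP h|[/fintype.subsetP h1 /forall_inP h2]].
    split; first by apply/fintype.subsetP => e /h; rewrite inE => /andP[].
    by apply/forall_inP => e /h; rewrite inE => /andP[].
  by apply/fintype.subsetP => e eF; rewrite inE h1 //= h2.
rewrite /nb_S2.
under eq_bigr => v _ do rewrite /degree -cards_draws -sum1dep_card big_mkcond /=.
rewrite exchange_big /= -sum1dep_card [RHS]big_mkcond /=.
apply: eq_bigr => F _; under eq_bigr => v _ do rewrite inc.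
case: (boolP (F \subset edges G)) => /= [FG|_]; last by rewrite big1.
case: (boolP (#|F| == 2%N)) => /= [F2|_]; last first.
  by rewrite big1 // => v _; rewrite andbF.
under eq_bigr => v _ do rewrite andbT.
case: existsP => [[v hv]|nv]; last first.
  by rewrite big1 // => v _; case: ifP => // h; case: nv; exists v.
rewrite (bigD1 v) //= hv big1 ?addn0 // => w wv; case: ifP => // hw.
have /cards2P[e [f [ef Fef]]] := F2.
have same g : g \in F -> g = [set v; w].
  move=> gF; apply/esym/eqP; rewrite eqEcard cards2 eq_sym wv.
  rewrite (edge_card (fintype.subsetP FG _ gF)) leqnn andbT.
  apply/fintype.subsetP => x; rewrite !inE => /orP[] /eqP ->.
    by move/forall_inP: hv; apply.
  by move/forall_inP: hw; apply.
have eF : e \in F by rewrite Fef set21.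
have fF : f \in F by rewrite Fef set22.
by case/eqP: ef; rewrite (same e eF) -(same f fF).
Qed.

End Graphs.

Definition S2_density (R : realType) (n : nat) (G : sgraph 'I_n) : R :=
  (nb_S2 G)%:R / (3 * 'C(n, 3))%:R.

(* When m <= 'C(n, 2) or k * l <= m fails, no graph satisfies the condition. *)
Definition graph_family (n m l k : nat) : {set sgraph 'I_n} :=
  [set G : sgraph 'I_n | (#|edges G| == m) &&
    [exists I : {set 'I_n},
      [&& independent G I, (l <= #|I|)%N & (k <= min_degree G I)%N]]].

(* The maximum over an empty family is -oo. The floors are taken with
   Num.truncn, which is the floor on nonnegative reals. *)
Definition max_S2_density (R : realType) (rho alpha beta : R) (n : nat)
    : \bar R :=
  \big[maxe/-oo%E]_(G in graph_family n
      (Num.truncn (rho * 'C(n, 2)%:R))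
      (Num.truncn (alpha * n%:R))
      (Num.truncn (beta * n%:R)))
    (S2_density R G)%:E.

Definition I_S2 (R : realType) (rho alpha beta : R) : \bar R :=
  limn_esup (max_S2_density rho alpha beta).

(* Main.v *)
Require Import Defs.
From mathcomp Require Import all_boot all_order all_algebra.
From mathcomp Require Import all_classical all_reals all_analysis.
From mathcomp Require Import ring lra zify.

(* Upper bound. Let G maximise the sum of squared degrees among the graphs with
   m edges in which a fixed set I of size a is independent with degrees at
   least a. Moving an edge uw to u'w, with u and u' outside I and
   d(u) <= d(u'), increases the sum, so the neighbourhoods of the vertices
   outside I are nested and these vertices split into a clique C and an
   independent set O.

   Put s = #|C|, k = s + a, and give each vertex of C a loop. The sum M of the
   degrees is then k^2 - a^2 + 2 Z, where Z is the sum over C and I of z, with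
   k + z(u) the degree of u in C and z(i) the number of neighbours in O of i
   in I. Write k * sum z^2 as Z^2 plus the sum of (z - z')^2 over pairs. As
   |z - z'| is controlled by the number of vertices of O and I that separate the
   pair, a vertex of O of degree D is charged at most a multiple of D (k - D),
   and the linear terms pay for this as soon as s >= n / 2; the vertices of I
   pay because their degrees are at least a. What remains is the tangent at
   X = k of a^3 + (X^2 - 2 a^2) X as a function of X^2 = M + a^2. That function
   is convex, and equals the claimed bound; its gap to the tangent also absorbs
   the deficit that appears when s < n / 2.

   Lower bound. Take a clique of size about n * sqrt (rho + alpha^2), remove the
   edges inside a set of about alpha * n of its vertices, and add arbitrary
   edges not inside that set. *)

Set Implicit Arguments.
Unset Strict Implicit.
Unset Printing Implicit Defensive.

Import Order.TTheory GRing.Theory Num.Theory.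
Import numFieldNormedType.Exports.

Local Open Scope ring_scope.

(** * Sums of squared differences and separating elements *)

Lemma sumr_cst (R : pzRingType) (V : finType) (A : {set V}) (x : R) :
  \sum_(i in A) x = #|A|%:R * x.
Proof. by rewrite sumr_const mulr_natl. Qed.

Lemma sum_sqr_sub (R : realFieldType) (V : finType) (A B : {set V})
    (f g : V -> R) :
  \sum_(x in A) \sum_(y in B) (f x - g y) ^+ 2 =
  #|B|%:R * (\sum_(x in A) f x ^+ 2)
    - 2 * (\sum_(x in A) f x) * (\sum_(y in B) g y)
    + #|A|%:R * (\sum_(y in B) g y ^+ 2).
Proof.
have -> : \sum_(x in A) \sum_(y in B) (f x - g y) ^+ 2 =
    \sum_(x in A) (#|B|%:R * f x ^+ 2 - (2 * \sum_(y in B) g y) * f x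
                   + \sum_(y in B) g y ^+ 2).
  apply: eq_bigr => x _.
  rewrite -sumr_cst mulrAC mulr_sumr -sumrB -big_split /=.
  by apply: eq_bigr => y _; ring.
by rewrite big_split sumrB /= -!mulr_sumr sumr_cst; ring.
Qed.

(** For 0/1 weights the left side counts the triples in which [p] joins [o] to [x] while [q] does
    not join it to [y]; summing over [o] first leaves only the degrees of [o]. *)
Lemma sum_separating (R : realFieldType) (V : finType) (A B O : {set V})
    (p q : V -> V -> R) :
  \sum_(x in A) \sum_(y in B) \sum_(o in O) p x o * (1 - q y o) =
  \sum_(o in O) (\sum_(x in A) p x o) * (#|B|%:R - \sum_(y in B) q y o).
Proof.
under eq_bigr => x _ do rewrite exchange_big /=.
rewrite exchange_big /=; apply: eq_bigr => o _; rewrite mulr_suml.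
apply: eq_bigr => x _; rewrite -mulr_sumr; congr (_ * _).
by rewrite sumrB sumr_cst mulr1.
Qed.

(** On each [o] the common part [p o * q o] cancels from the difference, and
    [p o * (1 - q o) + q o * (1 - p o) <= 1]. *)
Lemma sum_separating_bounds (R : realFieldType) (V : finType) (O : {set V})
    (p q : V -> R) :
    (forall o, 0 <= p o <= 1) -> (forall o, 0 <= q o <= 1) ->
  let x := \sum_(o in O) p o * (1 - q o) in
  let y := \sum_(o in O) q o * (1 - p o) in
  [/\ \sum_(o in O) p o - \sum_(o in O) q o = x - y, 0 <= x, 0 <= y
    & x + y <= #|O|%:R].
Proof.
move=> hp hq x y; split.
- by rewrite /x /y -!sumrB; apply: eq_bigr => o _; ring.
- by apply: sumr_ge0 => o _; move: (hp o) (hq o); nra.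
- by apply: sumr_ge0 => o _; move: (hp o) (hq o); nra.
rewrite /x /y -big_split -[leRHS]mulr1 -sumr_cst /=; apply: ler_sum => o _.
by move: (hp o) (hq o); nra.
Qed.

(** * The tangent inequality for weighted adjacencies between [C], [O] and [I] *)

Section Split.
Variables (R : realFieldType) (V : finType) (C O I : {set V}).
Variables (p h r : V -> V -> R).
Hypothesis p01 : forall x y, 0 <= p x y <= 1.
Hypothesis h01 : forall x y, 0 <= h x y <= 1.
Hypothesis r01 : forall x y, 0 <= r x y <= 1.

Let s : R := #|C|%:R.
Let l : R := #|O|%:R.
Let a : R := #|I|%:R.
Let k : R := s + a.
Let n : R := k + l.
Let w u := \sum_(o in O) p u o.
Let m u := \sum_(i in I) r u i.
Let v i := \sum_(o in O) h i o.
Let b i := \sum_(u in C) r u i.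
Let g o := \sum_(u in C) p u o.
Let c o := \sum_(i in I) h i o.
Let D o := g o + c o.

(** For a pair in [C] let [X <= l] and [Y <= a] be the weights of the elements of [O] and of [I]
    that separate it. The difference is at most [X + Y] in absolute value, and
    [(X + Y)^2 <= (l + 2 * a) * X + a * Y]: the cross term is charged to [O]. *)
Lemma CC_pairs :
  \sum_(u in C) \sum_(u' in C) ((w u - m u) - (w u' - m u')) ^+ 2 <=
  2 * ((l + 2 * a) * (\sum_(o in O) g o * (s - g o))
       + a * \sum_(i in I) b i * (s - b i)).
Proof.
have -> : 2 * ((l + 2 * a) * (\sum_(o in O) g o * (s - g o))
       + a * \sum_(i in I) b i * (s - b i)) =
  \sum_(u in C) \sum_(u' in C)
    ((l + 2 * a) * ((\sum_(o in O) p u o * (1 - p u' o))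
                    + \sum_(o in O) p u' o * (1 - p u o))
     + a * ((\sum_(i in I) r u i * (1 - r u' i))
            + \sum_(i in I) r u' i * (1 - r u i))).
  have sep (q : V -> V -> R) (T : {set V}) (A := \sum_(o in T)
      (\sum_(u in C) q u o) * (s - \sum_(u in C) q u o)) :
      \sum_(u in C) \sum_(u' in C) (\sum_(o in T) q u o * (1 - q u' o)) = A
      /\ \sum_(u in C) \sum_(u' in C) (\sum_(o in T) q u' o * (1 - q u o)) = A.
    by split; last rewrite exchange_big /=; rewrite sum_separating.
  under [RHS]eq_bigr => u _ do
    rewrite big_split -!mulr_sumr !big_split /=.
  rewrite big_split -!mulr_sumr !big_split /=.
  rewrite (sep p O).1 (sep p O).2 (sep r I).1 (sep r I).2 /g /b; ring.
apply: ler_sum => u _; apply: ler_sum => u' _.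
have [e1 x1 y1 z1] := sum_separating_bounds O (p01 u) (p01 u').
have [e2 x2 y2 z2] := sum_separating_bounds I (r01 u) (r01 u').
have -> : w u - m u - (w u' - m u') = (w u - w u') - (m u - m u') by ring.
rewrite /w /m e1 e2 -/l -/a in z1 z2 *.
move: (\sum_(_ in _) _) x1 y1 z1 x2 y2 z2 => x.
move: (\sum_(_ in _) _) (\sum_(_ in _) _) (\sum_(_ in _) _) => y x' y'.
move=> x1 y1 z1 x2 y2 z2.
have : (x - y - (x' - y')) ^+ 2 <= (x + y + (x' + y')) ^+ 2 by nra.
nra.
Qed.

(** Let [x] and [y] be the weights of the elements of [O] joined only to [u] and only to [i]. As
    [0 <= m u <= a], [(x - y - m u)^2 <= l * (x + y) + 2 * a * y + a * m u], so that only [y] bears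
    the cross term. *)
Lemma CI_pairs :
  \sum_(u in C) \sum_(i in I) ((w u - m u) - v i) ^+ 2 <=
  l * (\sum_(o in O) g o * (a - c o))
  + (l + 2 * a) * (\sum_(o in O) c o * (s - g o)) + a ^+ 2 * \sum_(i in I) b i.
Proof.
have -> : \sum_(i in I) b i = \sum_(u in C) m u by rewrite exchange_big.
have -> : l * (\sum_(o in O) g o * (a - c o))
  + (l + 2 * a) * (\sum_(o in O) c o * (s - g o)) + a ^+ 2 * \sum_(u in C) m u =
  \sum_(u in C) \sum_(i in I)
    (l * (\sum_(o in O) p u o * (1 - h i o))
     + (l + 2 * a) * (\sum_(o in O) h i o * (1 - p u o)) + a * m u).
  under [RHS]eq_bigr => u _ do
    rewrite !big_split -!mulr_sumr sumr_cst /=.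
  rewrite !big_split -!mulr_sumr /= sum_separating.
  have -> : \sum_(u in C) \sum_(i in I) (\sum_(o in O) h i o * (1 - p u o)) =
      \sum_(o in O) c o * (s - g o) by rewrite exchange_big sum_separating.
  by rewrite /g /c; ring.
apply: ler_sum => u _; apply: ler_sum => i _.
have [e1 x1 y1 z1] := sum_separating_bounds O (p01 u) (h01 i).
have m0 : 0 <= m u by apply: sumr_ge0 => j _; case/andP: (r01 u j).
have ma : m u <= a.
  rewrite -[a]mulr1 -sumr_cst; apply: ler_sum => j _; by case/andP: (r01 u j).
have -> : w u - m u - v i = (w u - v i) - m u by ring.
rewrite /w /v e1 -/l in z1 *.
move: (\sum_(_ in _) _) (\sum_(_ in _) _) x1 y1 z1 => x y x1 y1 z1.
have : (x - y) ^+ 2 <= (x + y) ^+ 2 by nra.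
nra.
Qed.

Lemma II_pairs :
  \sum_(i in I) \sum_(j in I) (v i - v j) ^+ 2 <=
  2 * l * \sum_(o in O) c o * (a - c o).
Proof.
have -> : 2 * l * (\sum_(o in O) c o * (a - c o)) =
  \sum_(i in I) \sum_(j in I)
    l * ((\sum_(o in O) h i o * (1 - h j o))
         + \sum_(o in O) h j o * (1 - h i o)).
  under [RHS]eq_bigr => u _ do rewrite -!mulr_sumr !big_split /=.
  rewrite -!mulr_sumr !big_split /= sum_separating.
  have -> : \sum_(i in I) \sum_(j in I) (\sum_(o in O) h j o * (1 - h i o)) =
      \sum_(o in O) c o * (a - c o) by rewrite exchange_big sum_separating.
  by rewrite /c; ring.
apply: ler_sum => i _; apply: ler_sum => j _.
have [e1 x1 y1 z1] := sum_separating_bounds O (h01 i) (h01 j).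
rewrite /v e1 -/l in z1 *.
move: (\sum_(_ in _) _) (\sum_(_ in _) _) x1 y1 z1 => x y x1 y1 z1.
have : (x - y) ^+ 2 <= (x + y) ^+ 2 by nra.
nra.
Qed.

Let Z := (\sum_(u in C) (w u - m u)) + \sum_(i in I) v i.

(** By Lagrange's identity, half of the sum in [CC_pairs], the sum in [CI_pairs] and half of the sum
    in [II_pairs] add up to [k] times the sum of squares minus [Z^2]. The charges are regrouped
    through [k - D = (s - g) + (a - c)]. *)
Lemma sum_sqr_excess :
  k * ((\sum_(u in C) (w u - m u) ^+ 2) + \sum_(i in I) v i ^+ 2) <=
  Z ^+ 2 + (\sum_(o in O) (l * D o * (k - D o) + 2 * a * (s - g o) * D o))
  + \sum_(i in I) (a * b i * (s - b i) + a ^+ 2 * b i).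
Proof.
have := CC_pairs; have := CI_pairs; have := II_pairs.
rewrite !sum_sqr_sub -/s -/a.
have -> : \sum_(o in O) (l * D o * (k - D o) + 2 * a * (s - g o) * D o) =
   (l + 2 * a) * (\sum_(o in O) g o * (s - g o))
   + l * (\sum_(o in O) g o * (a - c o))
   + (l + 2 * a) * (\sum_(o in O) c o * (s - g o))
   + l * \sum_(o in O) c o * (a - c o).
  rewrite !mulr_sumr -!big_split.
  by apply: eq_bigr => o _; rewrite /D /k /=; ring.
have -> : \sum_(i in I) (a * b i * (s - b i) + a ^+ 2 * b i) =
   a * (\sum_(i in I) b i * (s - b i)) + a ^+ 2 * \sum_(i in I) b i.
  by rewrite !mulr_sumr -!big_split; apply: eq_bigr => i _ /=; ring.
rewrite /Z /k; lra.
Qed.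

(* [p] and [h] stand for adjacency between [C] and [O] and between [I] and [O],
   but [r] for non-adjacency between [C] and [I]. With a loop at each vertex of
   the clique [C], the degrees in [C], [I] and [O] are [k + w u - m u],
   [s - b i + v i] and [D o]. *)
Lemma sum_sqr_degree_tangent :
    (forall i, i \in I -> a <= s - b i + v i) ->
  k * ((\sum_(u in C) (k + w u - m u) ^+ 2)
       + (\sum_(i in I) (s - b i + v i) ^+ 2) + \sum_(o in O) D o ^+ 2)
  + \sum_(o in O) (k - D o) * ((2 * s - n) * D o + 2 * a * c o) <=
  k * (a ^+ 3 + k ^+ 3 - 2 * a ^+ 2 * k) + (3 * k ^+ 2 - 2 * a ^+ 2) * Z
    + Z ^+ 2.
Proof.
move=> hI.
have s0 : 0 <= s by rewrite ler0n.
have a0 : 0 <= a by rewrite ler0n.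
have b0 i : 0 <= b i by apply: sumr_ge0 => j _; case/andP: (r01 j i).
have v0 i : 0 <= v i by apply: sumr_ge0 => j _; case/andP: (h01 i j).
have key := sum_sqr_excess.
(* These are the terms in [b] of the final comparison. The degree condition makes
   [s * b * (s - a - b + v)] nonnegative, and the rest is [(s + 2 * a) * v * b]. *)
have eI : 0 <= \sum_(i in I) (s * b i * (s - a - b i) + 2 * k * (v i * b i)).
  apply: sumr_ge0 => i /hI hi; move: (b0 i) (v0 i); rewrite /k.
  move: s0 a0 hi; move: s a (b i) (v i) => s' a' b' v' s0 a0 hi bi vi.
  have : 0 <= s' * b' * (s' - a' - b' + v') by rewrite !mulr_ge0 //; lra.
  have : 0 <= (s' + 2 * a') * (v' * b') by rewrite !mulr_ge0 //; lra.
  lra.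
have -> : \sum_(u in C) (k + w u - m u) ^+ 2 =
   s * k ^+ 2 + 2 * k * (\sum_(u in C) (w u - m u))
   + \sum_(u in C) (w u - m u) ^+ 2.
  rewrite mulr_sumr -[s * _]sumr_cst -!big_split.
  by apply: eq_bigr => u _ /=; ring.
have eb : \sum_(u in C) m u = \sum_(i in I) b i by rewrite exchange_big.
have eg : \sum_(u in C) w u = \sum_(o in O) g o by rewrite exchange_big.
have ec : \sum_(i in I) v i = \sum_(o in O) c o by rewrite exchange_big.
have -> : \sum_(i in I) (s - b i + v i) ^+ 2 =
   a * s ^+ 2 + 2 * s * (\sum_(i in I) v i) + - (2 * s) * (\sum_(i in I) b i)
   + (\sum_(i in I) v i ^+ 2) + - 2 * (\sum_(i in I) v i * b i)
   + \sum_(i in I) b i ^+ 2.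
  rewrite !mulr_sumr -[a * _]sumr_cst -!big_split.
  by apply: eq_bigr => u _ /=; ring.
move: key eI; rewrite /Z !sumrB eb eg ec.
have -> : \sum_(o in O) (l * D o * (k - D o) + 2 * a * (s - g o) * D o) =
   (l * k + 2 * a * s) * (\sum_(o in O) g o)
   + (l * k + 2 * a * s) * (\sum_(o in O) c o)
   + - l * (\sum_(o in O) D o ^+ 2) + - (2 * a) * \sum_(o in O) g o * D o.
  rewrite !mulr_sumr -!big_split.
  by apply: eq_bigr => o _; rewrite /D /=; ring.
have -> : \sum_(o in O) (k - D o) * ((2 * s - n) * D o + 2 * a * c o) =
   (2 * s - n) * k * (\sum_(o in O) g o)
   + (2 * s - n) * k * (\sum_(o in O) c o)
   + (n - 2 * s - 2 * a) * (\sum_(o in O) D o ^+ 2)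
   + 2 * a * k * (\sum_(o in O) c o) + 2 * a * (\sum_(o in O) g o * D o).
  rewrite !mulr_sumr -!big_split.
  by apply: eq_bigr => o _; rewrite /D /=; ring.
have -> : \sum_(i in I) (a * b i * (s - b i) + a ^+ 2 * b i) =
   (a * s + a ^+ 2) * (\sum_(i in I) b i) + - a * \sum_(i in I) b i ^+ 2.
  rewrite !mulr_sumr -!big_split.
  by apply: eq_bigr => o _; rewrite /D /=; ring.
have -> : \sum_(i in I) (s * b i * (s - a - b i) + 2 * k * (v i * b i)) =
   s * (s - a) * (\sum_(i in I) b i) + - s * (\sum_(i in I) b i ^+ 2)
    + 2 * k * (\sum_(i in I) v i * b i).
  rewrite !mulr_sumr -!big_split.
  by apply: eq_bigr => o _; rewrite /D /=; ring.
have ekn : n = k + l by [].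
have eka : k = s + a by [].
rewrite ekn eka; lra.
Qed.

End Split.

(** * Polynomial inequalities and the comparison with the tangent *)

Lemma bernstein_ge0 (R : realFieldType) (n i : nat) (u : R) :
  0 <= u <= 1 -> 0 <= u ^+ i * (1 - u) ^+ (n - i).
Proof. by case/andP=> u0 u1; rewrite mulr_ge0 ?exprn_ge0 ?subr_ge0. Qed.

(** The region is mapped onto the unit square by [u] and [v], where both sides have degree at most 4
    in each variable. The inequality then follows linearly from the nonnegativity of the products of
    Bernstein polynomials. *)
Lemma small_clique_poly (R : realFieldType) (a k : R) :
  165 / 1000 <= a <= 23 / 100 -> 449 / 1000 <= k <= 1 / 2 + a ->
  (1 + 2 * a - 2 * k) * (1 - k) * k ^+ 2 <=
  (4 / 5 + a / 5 - k) ^+ 2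
    * (2 * k ^+ 2 + 4 * a ^+ 2 - (4 / 5 + a / 5 - k) ^+ 2).
Proof.
move=> /andP[a1 a2] /andP[k1 k2].
pose v := (a - 165 / 1000) / (65 / 1000).
pose u := (k - 449 / 1000) / (51 / 1000 + a).
have v01 : 0 <= v <= 1 by rewrite /v; apply/andP; split; lra.
have w0 : 0 < 51 / 1000 + a by lra.
have u01 : 0 <= u <= 1.
  apply/andP; split; first by apply: divr_ge0; lra.
  by rewrite ler_pdivrMr // mul1r; lra.
have ea : a = 165 / 1000 + 65 / 1000 * v by rewrite /v; lra.
have ek : k = 449 / 1000 + u * (51 / 1000 + a).
  by rewrite /u divfK ?gt_eqF //; ring.
rewrite ek ea; move: u v u01 v01 {a1 a2 k1 k2 w0 ea ek} => u v u01 v01.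
have B i j := mulr_ge0 (bernstein_ge0 4 i u01) (bernstein_ge0 4 j v01).
have := B 0 0; have := B 0 1; have := B 0 2; have := B 0 3; have := B 0 4.
have := B 1 0; have := B 1 1; have := B 1 2; have := B 1 3; have := B 1 4.
have := B 2 0; have := B 2 1; have := B 2 2; have := B 2 3; have := B 2 4.
have := B 3 0; have := B 3 1; have := B 3 2; have := B 3 3; have := B 3 4.
have := B 4 0; have := B 4 1; have := B 4 2; have := B 4 3; have := B 4 4.
rewrite /subn /=.
lra.
Qed.

(** Normalised to [n = 1], the left side is four times the worst deficit caused by [s < n / 2], and
    the right side is, up to the same factor, the gap between the convex function and its tangent at
    [k]. *)
Lemma small_clique_gap (R : realFieldType) (a k x : R) :
    165 / 1000 <= a <= 23 / 100 -> 0 <= x ->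
    67 / 100 + a ^+ 2 <= x ^+ 2 <= 72 / 100 + a ^+ 2 ->
    (1 - k) ^+ 2 <= 1 - x ^+ 2 -> k <= 1 / 2 + a ->
  (1 + 2 * a - 2 * k) * (1 - k) * k ^+ 2
    <= (x - k) ^+ 2 * (k ^+ 2 + 2 * k * x - x ^+ 2 + 4 * a ^+ 2).
Proof.
move=> a12 x0 /andP[x1 x2] hk k2; have /andP[a1 a2] := a12.
have k1 : 449 / 1000 <= k by nra.
have x3 : x <= 88 / 100 by nra.
(* This affine lower bound of [sqrt (67 / 100 + a^2)], close to the tangent near [a = 1 / 6],
   eliminates [x]. *)
have x4 : 4 / 5 + a / 5 <= x by nra.
apply: le_trans (small_clique_poly a12 _) _; first by rewrite k1.
(* In terms of [y = (x - k) ^+ 2] the right-hand side is [y * (b - y)] with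
   [b = 2 * k ^+ 2 + 4 * a ^+ 2], which increases for [y <= b / 2]. *)
set y0 := (4 / 5 + a / 5 - k) ^+ 2.
have -> : k ^+ 2 + 2 * k * x - x ^+ 2 + 4 * a ^+ 2 =
    2 * k ^+ 2 + 4 * a ^+ 2 - (x - k) ^+ 2 by ring.
set y := (x - k) ^+ 2.
have yy : y0 <= y by rewrite /y0 /y; nra.
have yk : y <= k ^+ 2 by rewrite /y; nra.
have a3 : 0 <= a ^+ 2 by apply: sqr_ge0.
have : 0 <= (y - y0) * (2 * k ^+ 2 + 4 * a ^+ 2 - y - y0).
  by apply: mulr_ge0; lra.
lra.
Qed.

(** Since [z = (x^2 - k^2) / 2], the target times [k] exceeds the right side of the last hypothesis
    by exactly [(x - k)^2 * (k^2 + 2 * k * x - x^2 + 4 * a^2) / 4]. It remains to see that this gap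
    outweighs a negative [Q]. *)
Lemma tangent_bound (R : realFieldType) (n a s l k z S Q x : R) :
    0 <= s -> 0 <= l -> 0 < a -> k = s + a -> n = k + l ->
    165 / 1000 * n <= a <= 23 / 100 * n -> 0 <= x ->
    67 / 100 * n ^+ 2 + a ^+ 2 <= x ^+ 2 <= 72 / 100 * n ^+ 2 + a ^+ 2 ->
    x ^+ 2 = k ^+ 2 + 2 * z -> z <= l * k ->
    (n <= 2 * s -> 0 <= Q) ->
    (2 * s <= n -> - (n - 2 * s) * l * k ^+ 2 / 4 <= Q) ->
    k * S + Q <= k * (a ^+ 3 + k ^+ 3 - 2 * a ^+ 2 * k)
      + (3 * k ^+ 2 - 2 * a ^+ 2) * z + z ^+ 2 ->
  S <= a ^+ 3 + (x ^+ 2 - 2 * a ^+ 2) * x.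
Proof.
move=> s0 l0 a0 ek en ha x0 hx xz zlk Q1 Q2 H.
have k0 : 0 < k by lra.
have n0 : 0 < n by lra.
have gap : 0 <= (x - k) ^+ 2
    * (k ^+ 2 + 2 * k * x - x ^+ 2 + 4 * a ^+ 2) / 4 + Q.
  have [ns|sn] := leP n (2 * s).
    have xn : x <= n by nra.
    rewrite addr_ge0 ?Q1// divr_ge0// mulr_ge0 ?sqr_ge0//; nra.
  apply: le_trans (_ : (x - k) ^+ 2 * (k ^+ 2 + 2 * k * x - x ^+ 2 + 4 * a ^+ 2)
      / 4 + - (n - 2 * s) * l * k ^+ 2 / 4 <= _); last first.
    by rewrite lerD2l Q2// ltW.
  (* Everything is homogeneous, so the case of a small clique reduces to [n = 1]. *)
  have nV : n * n^-1 = 1 by rewrite divff ?gt_eqF.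
  have := @small_clique_gap _ (a / n) (k / n) (x / n).
  have -> : (165 / 1000 <= a / n <= 23 / 100).
    by rewrite ler_pdivlMr // ler_pdivrMr.
  have -> : (67 / 100 + (a / n) ^+ 2 <= (x / n) ^+ 2
      <= 72 / 100 + (a / n) ^+ 2).
    have e (c : R) : c + (a / n) ^+ 2 = (c * n ^+ 2 + a ^+ 2) / n ^+ 2.
      by field; rewrite gt_eqF.
    by rewrite !e expr_div_n !ler_pM2r ?invr_gt0 ?exprn_gt0.
  move=> /(_ isT (divr_ge0 x0 (ltW n0)) isT).
  have -> : (1 - k / n) ^+ 2 = l ^+ 2 / n ^+ 2.
    by rewrite en in n0 *; field; rewrite gt_eqF.
  have -> : 1 - (x / n) ^+ 2 = (n ^+ 2 - x ^+ 2) / n ^+ 2.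
    by field; rewrite gt_eqF.
  (* [x^2 = k^2 + 2 * z <= k^2 + 2 * l * k = n^2 - l^2]. *)
  rewrite ler_pM2r ?invr_gt0 ?exprn_gt0 // => /(_ _)/wrap[]; first by nra.
  have -> : k / n <= 1 / 2 + a / n.
    have -> : 1 / 2 + a / n = (n / 2 + a) / n by field; rewrite gt_eqF.
    by rewrite ler_pM2r ?invr_gt0 //; lra.
  move=> /(_ isT).
  rewrite -(ler_pM2r (exprn_gt0 4 n0)).
  have -> : (1 + 2 * (a / n) - 2 * (k / n)) * (1 - k / n) * (k / n) ^+ 2
       * n ^+ 4
     = (n + 2 * a - 2 * k) * (n - k) * k ^+ 2 by field; rewrite gt_eqF.
  have -> : (x / n - k / n) ^+ 2 * ((k / n) ^+ 2 + 2 * (k / n) * (x / n)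
      - (x / n) ^+ 2 + 4 * (a / n) ^+ 2) * n ^+ 4
     = (x - k) ^+ 2 * (k ^+ 2 + 2 * k * x - x ^+ 2 + 4 * a ^+ 2).
    by field; rewrite gt_eqF.
  have -> : (n + 2 * a - 2 * k) * (n - k) = (n - 2 * s) * l.
    by rewrite en ek; ring.
  by lra.
rewrite -(ler_pM2l k0).
have ez : z = (x ^+ 2 - k ^+ 2) / 2 by lra.
have : k * (a ^+ 3 + (x ^+ 2 - 2 * a ^+ 2) * x)
    - (k * (a ^+ 3 + k ^+ 3 - 2 * a ^+ 2 * k)
       + (3 * k ^+ 2 - 2 * a ^+ 2) * z + z ^+ 2) =
  (x - k) ^+ 2 * (k ^+ 2 + 2 * k * x - x ^+ 2 + 4 * a ^+ 2) / 4.
  by rewrite ez; field.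
lra.
Qed.

(** * Adjacency, degrees and double counting *)

Definition adj (V : finType) (G : sgraph V) (x y : V) : bool :=
  [set x; y]%SET \in edges G.

Lemma adjC (V : finType) (G : sgraph V) x y : adj G x y = adj G y x.
Proof. by rewrite /adj finset.setUC. Qed.

Lemma adjxx (V : finType) (G : sgraph V) x : adj G x x = false.
Proof.
by apply/negP => /edge_card; rewrite finset.setUid cards1.
Qed.

Lemma edgeP (V : finType) (G : sgraph V) (e : {set V}) : e \in edges G ->
  exists x y, [/\ x != y, adj G x y & e = [set x; y]%SET].
Proof.
move=> eG.
have /cards2P[x [y [xy exy]]] : #|e| == 2%N by rewrite (edge_card eG).
by exists x, y; split=> //; rewrite /adj -exy.
Qed.

Lemma independentP (V : finType) (G : sgraph V) (I : {set V}) :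
  reflect {in I &, forall x y, ~~ adj G x y} (independent G I).
Proof.
apply: (iffP forall_inP) => [h x y xI yI|h e eG].
  by apply/negP => /h; rewrite finset.subUset !finset.sub1set xI yI.
have [x [y [_ xy ->]]] := edgeP eG.
apply/negP; rewrite finset.subUset !finset.sub1set => /andP[xI yI].
by move: (h x y xI yI); rewrite xy.
Qed.

Lemma degree_card (V : finType) (G : sgraph V) v :
  degree G v = #|[set w | adj G v w]|.
Proof.
rewrite /degree; have -> : incident G v =
    [set [set v; w]%SET | w in [set w | adj G v w]]%SET.
  apply/finset.setP => e; rewrite inE.
  apply/andP/imsetP => [[eG ve]|[w]]; last first.
    by rewrite inE => vw ->; rewrite !inE eqxx.
  have [x [y [xy axy exy]]] := edgeP eG; move: ve; rewrite exy !inE.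
  case/orP=> /eqP ->; first by exists y; rewrite ?inE.
  by exists x; rewrite ?inE ?(adjC _ y) // finset.setUC.
rewrite card_in_imset // => w w'; rewrite !inE => vw vw' /finset.setP/(_ w).
rewrite !inE eqxx orbT => /esym/orP[/eqP wv|/eqP//].
by move: vw; rewrite wv adjxx.
Qed.

Lemma degree_adj (R : pzSemiRingType) (V : finType) (G : sgraph V) v :
  (degree G v)%:R = \sum_w (adj G v w)%:R :> R.
Proof.
rewrite -natr_sum degree_card -sum1dep_card big_mkcond.
by congr (_%:R); apply: eq_bigr => w _; case: adj.
Qed.

Lemma degree_sum (V : finType) (G : sgraph V) v :
  (degree G v = \sum_(e in edges G) (v \in e))%N.
Proof.
rewrite /degree -sum1dep_card big_mkcondr /=.
by apply: eq_bigr => e _; case: (v \in e).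
Qed.

Lemma handshake (V : finType) (G : sgraph V) :
  (\sum_v degree G v = 2 * #|edges G|)%N.
Proof.
under eq_bigr => v _ do rewrite degree_sum.
rewrite exchange_big /= mulnC -sum_nat_const; apply: eq_bigr => e eG.
rewrite -(edge_card eG) -sum1_card [RHS]big_mkcond /=.
by apply: eq_bigr => v _; case: (v \in e).
Qed.

Lemma sum_split3 (R : nmodType) (V : finType) (C I : {set V}) (f : V -> R) :
    C \subset ~: I ->
  \sum_x f x = \sum_(x in C) f x + \sum_(x in ~: (C :|: I)) f x
               + \sum_(x in I) f x.
Proof.
move=> CI; rewrite (bigID [in I]) /= addrC; congr (_ + _).
rewrite (bigID [in C]) /=; congr (_ + _); apply: eq_bigl => x.
  have [xC|_] := boolP (x \in C); rewrite ?andbF // andbT.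
  by have := fintype.subsetP CI _ xC; rewrite inE.
by rewrite !inE negb_or andbC.
Qed.

(** * The bound for graphs split into a clique and two independent sets *)

Section SplitGraph.
Variables (R : rcfType) (V : finType) (G : sgraph V) (C I : {set V}).
Let O : {set V} := ~: (C :|: I).
Let s : R := #|C|%:R.
Let l : R := #|O|%:R.
Let a : R := #|I|%:R.
Let k : R := s + a.
Let n : R := #|V|%:R.
Let M : R := (2 * #|edges G|)%:R + n.
Let p x y : R := (adj G x y)%:R.
Let r x y : R := 1 - (adj G x y)%:R.

Hypothesis CI : C \subset ~: I.
Hypothesis cliqueC : {in C &, forall x y, x != y -> adj G x y}.
Hypothesis indO : {in O &, forall x y, ~~ adj G x y}.
Hypothesis indI : {in I &, forall x y, ~~ adj G x y}.

Let eqn_n : n = k + l.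
Proof.
have /(congr1 (fun x => x%:R : R)) := sum_split3 (fun=> 1%N) CI.
by rewrite !sum1_card !natrD /n /k /l /s /a => ->; rewrite addrAC.
Qed.

Let deg_C u : u \in C -> (degree G u)%:R + 1 =
  k + (\sum_(o in O) p u o) - \sum_(i in I) r u i.
Proof.
move=> uC; rewrite (degree_adj R) (sum_split3 _ CI) sumrB sumr_cst mulr1.
have -> : \sum_(x in C) (adj G u x)%:R = s - 1 :> R.
  have -> : s = \sum_(x in C) 1 by rewrite sumr_const.
  rewrite !(bigD1 u uC) /= adjxx add0r addrAC subrr add0r.
  by apply: eq_bigr => x /andP[xC xu]; rewrite cliqueC // eq_sym.
rewrite /k /p /a; ring.
Qed.

Let deg_I i : i \in I -> (degree G i)%:R =
  s - (\sum_(u in C) r u i) + \sum_(o in O) p i o.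
Proof.
move=> iI; rewrite (degree_adj R) (sum_split3 _ CI) sumrB sumr_cst mulr1.
rewrite [X in _ + X]big1 ?addr0; last first.
  by move=> j jI; rewrite (negbTE (indI iI jI)).
have -> : \sum_(x in C) (adj G i x)%:R = \sum_(u in C) (adj G u i)%:R :> R.
  by apply: eq_bigr => u _; rewrite adjC.
by rewrite /s /p; ring.
Qed.

Let deg_O o : o \in O -> (degree G o)%:R =
  \sum_(u in C) p u o + \sum_(i in I) p i o.
Proof.
move=> oO; rewrite (degree_adj R) (sum_split3 _ CI).
rewrite [X in _ + X + _]big1 ?addr0; last first.
  by move=> j jI; rewrite (negbTE (indO oO jI)).
by congr (_ + _); apply: eq_bigr => u _; rewrite adjC.
Qed.

(** Loops are put on [C] only, so the degree sum becomes [2 * #|edges G| + s]. As [s] depends on the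
    split, it is replaced by [n] at the very end, the bound being increasing in this quantity. *)
Lemma split_sum_sqr_degree :
    (0 < #|I|)%N -> (forall i, i \in I -> (#|I| <= degree G i)%N) ->
    165 / 1000 * n <= a <= 23 / 100 * n ->
    67 / 100 * n ^+ 2 <= (2 * #|edges G|)%:R ->
    (2 * #|edges G|)%:R + n <= 72 / 100 * n ^+ 2 ->
  \sum_v (degree G v)%:R ^+ 2 <=
    a ^+ 3 + (M - a ^+ 2) * Num.sqrt (M + a ^+ 2).
Proof.
move=> I0 degI ha hM1 hM2.
have b01 (b : bool) : 0 <= (b%:R : R) <= 1.
  by case: b; rewrite /= ?ler01 ?lexx.
have p01 x y : 0 <= p x y <= 1 by apply: b01.
have r01 x y : 0 <= r x y <= 1 by rewrite /r; move: (b01 (adj G x y)); lra.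
have s0 : 0 <= s by rewrite ler0n.
have l0 : 0 <= l by rewrite ler0n.
have a0 : 0 < a by rewrite ltr0n.
have hI i : i \in I -> a <= s - (\sum_(u in C) r u i) + \sum_(o in O) p i o.
  by move=> iI; rewrite -deg_I // ler_nat degI.
have := @sum_sqr_degree_tangent R V C O I _ _ _ p01 p01 r01 hI.
cbv zeta; rewrite -/s -/l -/a -/k -eqn_n.
set S := (X in k * X + _ <= _); set Q := (X in _ + X <= _).
set Z := (X in _ <= _ + X ^+ 2) => key.
have D0 o : 0 <= \sum_(u in C) p u o + \sum_(i in I) p i o.
  by rewrite addr_ge0 // sumr_ge0 // => x _; case/andP: (p01 x o).
have c0 o : 0 <= \sum_(i in I) p i o.
  by rewrite sumr_ge0 // => x _; case/andP: (p01 x o).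
have Dk o : \sum_(u in C) p u o + \sum_(i in I) p i o <= k.
  by rewrite lerD // -[leRHS]mulr1 -sumr_cst ler_sum // => x _;
    case/andP: (p01 x o).
have eZ : Z = \sum_(o in O) (\sum_(u in C) p u o + \sum_(i in I) p i o)
              - \sum_(i in I) \sum_(u in C) r u i.
  rewrite /Z sumrB big_split /= [\sum_(u in C) _]exchange_big /=.
  rewrite [\sum_(u in C) \sum_(i in I) _]exchange_big /=.
  by rewrite [\sum_(i in I) \sum_(o in O) _]exchange_big /= addrAC.
have Zlk : Z <= l * k.
  rewrite eZ lerBlDr ler_wpDr //.
    apply: sumr_ge0 => i _; apply: sumr_ge0 => u _.
    by case/andP: (r01 u i).
  by rewrite -sumr_cst ler_sum.
pose x := Num.sqrt ((2 * #|edges G|)%:R + s + a ^+ 2).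
have ex : x ^+ 2 = (2 * #|edges G|)%:R + s + a ^+ 2.
  by rewrite sqr_sqrtr // !addr_ge0 ?sqr_ge0 // ler0n.
have sn : s <= n by rewrite ler_nat max_card.
have xZ : x ^+ 2 = k ^+ 2 + 2 * Z.
  rewrite ex -handshake natr_sum (sum_split3 _ CI).
  have -> : \sum_(x in C) (degree G x)%:R = (\sum_(u in C)
      (k + (\sum_(o in O) p u o - \sum_(i in I) r u i)) - 1 *+ #|C|) :> R.
    by rewrite -sumr_const -sumrB; apply: eq_bigr => u /deg_C; lra.
  rewrite -/O (eq_bigr _ deg_O) (eq_bigr _ deg_I).
  have -> : \sum_(i in I) (s - \sum_(u in C) r u i + \sum_(o in O) p i o) =
      a * s - (\sum_(i in I) \sum_(u in C) r u i)
      + \sum_(i in I) \sum_(o in O) p i o.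
    by rewrite big_split sumrB sumr_cst.
  rewrite [\sum_(u in C) _]big_split sumr_cst /=.
  have -> : 1 *+ #|C| = s by [].
  move: (eZ); rewrite /Z -/s -/a /k; lra.
have {}key : S <= a ^+ 3 + (x ^+ 2 - 2 * a ^+ 2) * x.
  apply: (tangent_bound s0 l0 a0 _ eqn_n ha _ _ xZ Zlk _ _ key) => //.
  - by rewrite sqrtr_ge0.
  - by rewrite ex; apply/andP; split; lra.
  - move=> ns; apply: sumr_ge0 => o _; rewrite mulr_ge0 ?subr_ge0 //.
    by rewrite addr_ge0 // mulr_ge0 //; lra.
  (* For [2 * s <= n] the term [(2 * s - n) * D * (k - D)] is smallest at [D = k / 2]. *)
  move=> ns; have -> : - (n - 2 * s) * l * k ^+ 2 / 4 =
      l * (- (n - 2 * s) * k ^+ 2 / 4) by ring.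
  rewrite -sumr_cst; apply: ler_sum => o _.
  move: (c0 o) (D0 o) (Dk o) => c1; set D := _ + _ => D1 D2.
  have : 0 <= (n - 2 * s) * (k / 2 - D) ^+ 2.
    by rewrite mulr_ge0 ?sqr_ge0 //; lra.
  have : 0 <= (k - D) * (2 * a * \sum_(i in I) p i o).
    by rewrite mulr_ge0 //; [lra|rewrite mulr_ge0 //; lra].
  lra.
have dS : \sum_v (degree G v)%:R ^+ 2 <= S.
  rewrite (sum_split3 _ CI) /S addrAC; apply: lerD; first apply: lerD.
  - apply: ler_sum => u uC; rewrite -deg_C // lerXn2r ?nnegrE ?ler0n //; lra.
  - by apply: ler_sum => i iI; rewrite -deg_I.
  by apply: ler_sum => o oO; rewrite -deg_O.
apply: le_trans dS (le_trans key _); rewrite lerD2l.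
have e : M + a ^+ 2 = x ^+ 2 + (n - s) by rewrite ex /M; lra.
have a1 : a ^+ 2 <= n ^+ 2 / 2 by nra.
apply: ler_pM; last by apply: ler_wsqrtr; rewrite !lerD2r lerD2l.
- by rewrite ex; nra.
- by rewrite sqrtr_ge0.
by lra.
Qed.

End SplitGraph.

(** * Exchanging edges and the structure of a maximiser *)

Lemma exchange_edge (V : finType) (G : sgraph V) (f g : {set V}) :
    #|f| = 2%N -> f \notin edges G -> g \in edges G ->
  exists G' : sgraph V, [/\ edges G' = (f |: (edges G :\ g))%SET,
    #|edges G'| = #|edges G| &
    forall x, (degree G' x + (x \in g) = degree G x + (x \in f))%N].
Proof.
move=> f2 fG gG.
have E2 : [forall e in (f |: (edges G :\ g))%SET, #|e| == 2%N].
  apply/forall_inP => e; rewrite !inE => /orP[/eqP->|/andP[_ eG]].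
    by rewrite f2.
  by rewrite (edge_card eG).
have fg : f \notin (edges G :\ g)%SET by rewrite !inE negb_and fG orbT.
exists (SGraph E2).
split=> //=; first by rewrite cardsU1 fg [RHS](cardsD1 g) gG.
move=> x; rewrite !degree_sum /= big_setU1 //= (big_setD1 g gG) /=.
by rewrite addnC [RHS]addnC addnCA.
Qed.

(** The set [I] is fixed here, so that exchanges can be required to respect it. *)
Definition edge_family (V : finType) (m K : nat) (I : {set V}) :
    pred (sgraph V) :=
  fun G => [&& #|edges G| == m, independent G I
             & [forall i in I, (K <= degree G i)%N]].

Definition sum_sqr_degree (V : finType) (G : sgraph V) : nat :=
  \sum_v degree G v ^ 2.

(** Here [x] is the degree of the losing vertex after the move and [r] collects the other vertices.
    Hence the gain is strict even if the two degrees were equal before the move. *)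
Lemma sqr_spread (x y r : nat) : (x < y)%N ->
  (x.+1 ^ 2 + (y ^ 2 + r) < x ^ 2 + (y.+1 ^ 2 + r))%N.
Proof.
move=> xy; have sqrS z : (z.+1 ^ 2 = z ^ 2 + z.*2 + 1)%N.
  by rewrite -addn1 sqrnD muln1 exp1n -mul2n addnAC.
rewrite !sqrS; lia.
Qed.

Section Optimal.
Variables (V : finType) (m K : nat) (I : {set V}) (G : sgraph V).
Hypothesis famG : edge_family m K I G.
Hypothesis maxG : forall G', edge_family m K I G' ->
  (sum_sqr_degree G' <= sum_sqr_degree G)%N.

(** Otherwise the edge [wu] could be moved to [wu']. The set [I] stays independent because [u'] is
    outside it, no vertex of [I] loses degree because [w] keeps its own and [u] is outside [I], and
    the sum of squares grows. *)
Lemma optimal_nested u u' w : u \notin I -> u' \notin I ->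
    (degree G u <= degree G u')%N -> adj G w u -> w != u' -> adj G w u'.
Proof.
move=> uI u'I duu' wu wu'; apply/negPn/negP => nwu'.
have uw : u != w by apply: contraTneq wu => ->; rewrite adjxx.
have uu' : u != u' by apply: contraNneq nwu' => <-.
have [|G' [eG' cG' dG']] := exchange_edge _ nwu' wu.
  by rewrite cards2 wu'.
have /and3P[/eqP cG indG /forall_inP degG] := famG.
have famG' : edge_family m K I G'.
  apply/and3P; split; first by rewrite cG' cG.
    apply/forall_inP => e; rewrite eG' !inE => /orP[/eqP->|/andP[_ eG]].
      by rewrite finset.subUset !finset.sub1set (negbTE u'I) andbF.
    exact: (forall_inP indG).
  apply/forall_inP => i iI; move: (degG i iI) (dG' i); rewrite !inE.
  have -> : i == u = false by apply: contraNF uI => /eqP <-.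
  case: (i == w) => dGi /= => [/addIn->//|]; rewrite addn0 => ->.
  exact: leq_trans (leq_addr _ _).
have split2 (f : V -> nat) : (\sum_x f x =
    f u + (f u' + \sum_(x | (x != u) && (x != u')) f x))%N.
  by rewrite (bigD1 u) // (bigD1 u') //= eq_sym.
have := maxG famG'; rewrite /sum_sqr_degree !split2.
rewrite (eq_bigr (fun x => degree G x ^ 2)%N); last first.
  move=> x /andP[xu xu']; have := dG' x.
  by rewrite !inE (negbTE xu) (negbTE xu') !orbF => /addIn ->.
have := dG' u'.
rewrite !inE eqxx orbT ![u' == _]eq_sym (negbTE wu') (negbTE uu').
rewrite addn0 addn1 => ->.
have := dG' u.
rewrite !inE eqxx orbT (negbTE uw) (negbTE uu') addn0 addn1 => du.
by rewrite leqNgt -du sqr_spread // du.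
Qed.

Lemma optimal_split : exists C : {set V}, [/\ C \subset ~: I,
  {in C &, forall x y, x != y -> adj G x y} &
  {in ~: (C :|: I) &, forall x y, ~~ adj G x y}].
Proof.
(* Of two vertices of [C] the one of smaller degree forces the edge between them; a vertex outside
   [C] and [I] comes with a non-neighbour of at least its degree. *)
pose C := [set u in ~: I | [forall u' in ~: I,
  (u' != u) && (degree G u <= degree G u')%N ==> adj G u u']]%SET.
have inC u : u \in C = (u \in ~: I) && [forall u' in ~: I,
  (u' != u) && (degree G u <= degree G u')%N ==> adj G u u'] by rewrite inE.
exists C; split.
- by apply/fintype.subsetP => u; rewrite inC => /andP[].
- move=> x y; rewrite !inC.
  move=> /andP[xI /forall_inP hx] /andP[yI /forall_inP hy] xy.
  have [xy'|/ltnW yx] := leqP (degree G x) (degree G y).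
    by have := hx y yI; rewrite eq_sym xy xy'.
  by have := hy x xI; rewrite xy yx adjC.
have notC x : x \in ~: (C :|: I) -> x \notin I /\ exists2 p, p \notin I &
    [/\ p != x, (degree G x <= degree G p)%N & ~~ adj G x p].
  rewrite inE finset.in_setU negb_or inC => /andP[xC xI]; split=> //.
  move: xC; rewrite inE xI /= => /forallPn[p]; rewrite !negb_imply.
  by case/and3P; rewrite inE => pI /andP[px xp] nxp; exists p.
move=> x y; wlog xy : x y / (degree G x <= degree G y)%N.
  move=> H xO yO; have [xy|/ltnW yx] := leqP (degree G x) (degree G y).
    exact: H.
  by rewrite adjC; apply: H.
move=> /notC[xI [p pI [px xp nxp]]] /notC[yI [q qI [qy yq nyq]]].
apply/negP => axy.
have qx : q != x by apply: contraNneq nyq => ->; rewrite adjC.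
(* [y] is joined to [x], whose degree is at most that of [q], so nestedness joins [y] to [q],
   against the choice of [q]. *)
have ayq : adj G y q.
  apply: (@optimal_nested x) => //; first exact: leq_trans xy yq.
    by rewrite adjC.
  by rewrite eq_sym.
by rewrite ayq in nyq.
Qed.

End Optimal.

Lemma sum_sqr_degree_le (R : rcfType) (V : finType) (m : nat) (I : {set V})
    (G : sgraph V) (n := #|V|%:R : R) (a := #|I|%:R : R)
    (M := (2 * m)%:R + n : R) :
    edge_family m #|I| I G -> (0 < #|I|)%N ->
    165 / 1000 * n <= a <= 23 / 100 * n ->
    67 / 100 * n ^+ 2 <= (2 * m)%:R -> M <= 72 / 100 * n ^+ 2 ->
  (sum_sqr_degree G)%:R <= a ^+ 3 + (M - a ^+ 2) * Num.sqrt (M + a ^+ 2).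
Proof.
move=> famG I0 ha hM1 hM2.
have [G' famG' maxG'] := arg_maxnP (@sum_sqr_degree V) famG.
have {}maxG' G1 : edge_family m #|I| I G1 ->
  (sum_sqr_degree G1 <= sum_sqr_degree G')%N by move/maxG'.
apply: le_trans (_ : (sum_sqr_degree G')%:R <= _).
  by rewrite ler_nat maxG'.
have [C [CI cliqueC indO]] := optimal_split famG' maxG'.
have /and3P[/eqP cG' /independentP indI /forall_inP degI] := famG'.
have := @split_sum_sqr_degree R V G' C I CI cliqueC indO indI I0 degI ha.
rewrite cG' => /(_ hM1 hM2); congr (_ <= _); rewrite /sum_sqr_degree natr_sum.
by apply: eq_bigr => v _; rewrite natrX.
Qed.

(** * The construction for the lower bound *)

Lemma exists_between_card (T : finType) (A B : {set T}) (m : nat) :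
    A \subset B -> (#|A| <= m <= #|B|)%N ->
  exists2 E : {set T}, (A \subset E) && (E \subset B) & #|E| = m.
Proof.
move=> AB /andP[]; elim: m => [|m IHm].
  by rewrite leqn0 => /eqP A0 _; exists A; rewrite ?subxx.
rewrite leq_eqVlt => /orP[/eqP <- _|/IHm{}IHm mB].
  by exists A; rewrite ?subxx.
have [E /andP[AE EB] cE] := IHm (ltnW mB).
have : (0 < #|B :\: E|)%N by rewrite cardsDS // subn_gt0 cE.
case/card_gt0P => x; rewrite inE => /andP[xE xB].
exists (x |: E)%SET; last by rewrite cardsU1 xE cE.
rewrite finset.subUset EB finset.sub1set xB (fintype.subset_trans AE) //.
exact: finset.subsetUr.
Qed.

Lemma sum_ord_lt (n p : nat) : (p <= n)%N ->
  (\sum_(i < n | i < p) 1 = p)%N.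
Proof.
move=> pn; rewrite -(big_ord_widen n (fun=> 1%N) pn) sum_nat_const card_ord.
by rewrite muln1.
Qed.

Lemma sum_ord_steps (n a p A B : nat) : (a <= p <= n)%N ->
  (\sum_(v < n) (if v < a then A else if v < p then B else 0) =
   a * A + (p - a) * B)%N.
Proof.
case/andP=> ap pn; rewrite (bigID (fun v : 'I_n => v < a)%N) /=.
rewrite (eq_bigr (fun=> A)) => [|v -> //].
rewrite -(big_ord_widen n (fun=> A) (leq_trans ap pn)) sum_nat_const card_ord.
congr (_ + _)%N.
rewrite (eq_bigr (fun v : 'I_n => if v < p then B else 0)%N); last first.
  by move=> v /negbTE ->.
rewrite -big_mkcondr /= sum_nat_const; congr (_ * _)%N.
rewrite -{2}(sum_ord_lt pn).
rewrite (bigID (fun v : 'I_n => v < a)%N) /=.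
rewrite (eq_bigl (fun v : 'I_n => v < a)%N).
  rewrite sum_ord_lt ?(leq_trans ap pn) // addKn.
  by rewrite -sum1_card; apply: eq_bigl => v; rewrite [LHS]andbC.
by move=> v; apply/andb_idl => /leq_trans; apply.
Qed.

(** The clique on the first [p] vertices without the edges inside the first [a]. For [p = n] it
    contains every graph in which the first [a] vertices are independent. *)
Definition clique_sub_edges (n a p : nat) : {set {set 'I_n}} :=
  [set e : {set 'I_n} | [&& #|e| == 2%N, [forall x in e, (x < p)%N]
                          & [exists x in e, (a <= x)%N]]].

Lemma clique_sub_card2 n a p :
  [forall e in clique_sub_edges n a p, #|e| == 2%N].
Proof. by apply/forall_inP => e; rewrite inE => /and3P[]. Qed.

Definition clique_sub (n a p : nat) : sgraph 'I_n :=
  SGraph (clique_sub_card2 n a p).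

Lemma adj_clique_sub n a p (x y : 'I_n) : adj (clique_sub n a p) x y =
  [&& x != y, x < p, y < p & (a <= x) || (a <= y)]%N.
Proof.
rewrite /adj inE cards2 eqSS eqb1; congr (_ && _).
rewrite andbA; congr (_ && _).
  apply/forall_inP/andP => [h|[xp yp] z]; last first.
    by rewrite !inE => /orP[] /eqP ->.
  by split; apply: h; rewrite !inE eqxx ?orbT.
apply/exists_inP/orP => [[z]|].
  by rewrite !inE => /orP[] /eqP ->; [left|right].
by case=> h; [exists x|exists y] => //; rewrite !inE eqxx ?orbT.
Qed.

Lemma degree_clique_sub n a p (v : 'I_n) : (a <= p <= n)%N ->
  degree (clique_sub n a p) v =
  (if v < a then p - a else if v < p then p.-1 else 0)%N.
Proof.
move=> apn; have /andP[ap pn] := apn; rewrite degree_card -sum1dep_card.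
under eq_bigl => w do rewrite adj_clique_sub.
have [va|av] := ltnP v a.
  have := sum_ord_steps 0 1 apn; rewrite muln0 muln1 add0n => <-.
  rewrite big_mkcond; apply: eq_bigr => w _.
  rewrite (leq_trans va ap) /= [(a <= w)%N]leqNgt.
  case: (ltnP w a) => wa; first by rewrite !andbF.
  have -> : v != w by apply: contraTneq va => ->; rewrite -leqNgt.
  by rewrite andbT; case: (w < p)%N.
have [vp|pv] := ltnP v p; last by rewrite big1 // => w /and3P[].
rewrite -[in RHS](sum_ord_lt pn) [in RHS](bigD1 v) //=.
by apply: eq_bigl => w; rewrite eq_sym andbT andbC.
Qed.

(** Used with the identity to count edges and with ['C(d, 2)] to count stars; [f 0 = 0] discards the
    isolated vertices. *)
Lemma sum_clique_sub n a p (f : nat -> nat) : (a <= p <= n)%N -> f 0%N = 0%N ->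
  (\sum_v f (degree (clique_sub n a p) v) = a * f (p - a) + (p - a) * f p.-1)%N.
Proof.
move=> apn f0; rewrite -(sum_ord_steps _ _ apn); apply: eq_bigr => v _.
by rewrite degree_clique_sub //; do 2!case: ifP => // _.
Qed.

(** Any edge set of size [m] between those of [clique_sub n a p] and [clique_sub n a n] will do: the
    larger one keeps the first [a] vertices independent, and the smaller one gives them degree at
    least [p - a >= a] and provides the stars. *)
Lemma exists_dense_graph (n a p m : nat) :
    (a <= p <= n)%N -> (2 * a <= p)%N ->
    (a * (p - a) + (p - a) * p.-1 <= 2 * m)%N ->
    (2 * m <= a * (n - a) + (n - a) * n.-1)%N ->
  exists2 G, G \in graph_family n m a a &
    (a * 'C(p - a, 2) + (p - a) * 'C(p.-1, 2) <= nb_S2 G)%N.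
Proof.
move=> apn a2 hm1 hm2; have /andP[ap pn] := apn.
have ann : (a <= n <= n)%N by rewrite leqnn (leq_trans ap pn).
have [||E /andP[HE EH] cE] :=
  @exists_between_card _ (clique_sub n a p) (clique_sub n a n) m.
- apply/fintype.subsetP => e; rewrite !inE => /and3P[-> _ ->]; rewrite andbT.
  by apply/forall_inP => x _.
- have H q : (a <= q <= n)%N -> (2 * #|clique_sub_edges n a q| =
      a * (q - a) + (q - a) * q.-1)%N.
    move=> aqn; rewrite -(handshake (clique_sub n a q)).
    exact: (@sum_clique_sub _ _ _ id).
  by apply/andP; split; rewrite -(@leq_pmul2l 2) // H.
have E2 : [forall e in E, #|e| == 2%N].
  by apply/forall_inP => e /(fintype.subsetP EH); rewrite inE => /andP[].
have dG v : (degree (clique_sub n a p) v <= degree (SGraph E2) v)%N.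
  rewrite subset_leq_card //; apply/fintype.subsetP => e /setIdP[eH ve].
  by apply/setIdP; split=> //; apply: (fintype.subsetP HE).
exists (SGraph E2); last first.
  rewrite -(sum_clique_sub (f := fun d => 'C(d, 2)) apn) //.
  by apply: leq_sum => v _; apply: leq_bin2l.
rewrite inE /= cE eqxx /=; apply/existsP; exists [set v : 'I_n | (v < a)%N]%SET.
apply/and3P; split.
- apply/forall_inP => e /(fintype.subsetP EH).
  rewrite inE => /and3P[_ _ /exists_inP[x xe ax]].
  by apply/negP => /fintype.subsetP/(_ x xe); rewrite inE ltnNge ax.
- by rewrite -sum1dep_card sum_ord_lt // (leq_trans ap pn).
rewrite leq_min_degree ?card_ord ?(leq_trans ap pn) //; apply/forall_inP => v.
rewrite inE => va; apply: leq_trans (dG v); rewrite degree_clique_sub // va.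
by rewrite leq_subRL // addnn -mul2n.
Qed.

(** * Density bounds for finite [n] *)

Lemma mul2_bin2 d : (2 * 'C(d, 2) = d * d.-1)%N.
Proof. by rewrite mulnC (bin_ffact d 2) /falling_factorial /= muln1. Qed.

Lemma bin2_real (R : realDomainType) d :
  2 * 'C(d, 2)%:R = d%:R * (d%:R - 1) :> R.
Proof.
have /(congr1 (fun x => x%:R : R)) := mul2_bin2 d; rewrite natrM => ->.
by case: d => [|d]; rewrite ?mul0r // natrM -[d.+1.-1]/d -natr1 addrK.
Qed.

Lemma S2_densityE (R : realType) n (G : sgraph 'I_n) : (2 < n)%N ->
  S2_density R G =
  (2 * (nb_S2 G)%:R) / (n%:R * (n%:R - 1) * (n%:R - 2)).
Proof.
move=> n2; have e : 2 * (3 * 'C(n, 3))%:R = n%:R * (n%:R - 1) * (n%:R - 2) :> R.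
  rewrite -natrM mulnA mulnC (bin_ffact n 3) /falling_factorial /= muln1.
  case: n n2 {G} => // -[|[|n]] // _; rewrite !natrM /=.
  by rewrite -!natr1; ring.
have d0 : (3 * 'C(n, 3))%:R != 0 :> R.
  by rewrite pnatr_eq0 -lt0n muln_gt0 bin_gt0.
by rewrite /S2_density -e invfM mulrACA divff // mul1r.
Qed.

Lemma truncn_mul_bounds (R : realType) (c y : R) : 0 <= c -> 0 <= y ->
  c * y - 1 < (Num.truncn (c * y))%:R <= c * y.
Proof.
move=> c0 y0; have := truncn_itv (mulr_ge0 c0 y0).
by rewrite -natr1 => /andP[-> h]; rewrite ltrBlDr h.
Qed.

Lemma truncn_bin2_bounds (R : realType) (c : R) n : 0 <= c ->
  c * (n%:R * (n%:R - 1)) - 2 < (2 * Num.truncn (c * 'C(n, 2)%:R))%:R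
    <= c * (n%:R * (n%:R - 1)).
Proof.
move=> c0; have /andP[h1 h2] := truncn_mul_bounds c0 (ler0n R 'C(n, 2)).
by rewrite natrM -bin2_real; apply/andP; split; lra.
Qed.

(** Here [e] is [1 / n]: [rho + e] accounts for the loops, [alpha - e] for the floor, and the
    denominator for [n * (n - 1) * (n - 2)] against [n^3]. *)
Definition density_upper (R : realType) (rho alpha e : R) : R :=
  (alpha ^+ 3 + (rho + e - (alpha - e) ^+ 2) * Num.sqrt (rho + e + alpha ^+ 2))
    / ((1 - e) * (1 - 2 * e)).

(** Here [e] is [1 / n], and [x * n] is the clique size before rounding; the multiples of [e] bound
    the rounding losses in the star count of [clique_sub]. *)
Definition density_lower (R : realType) (rho alpha e : R) : R :=
  let x := Num.sqrt (rho + alpha ^+ 2) in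
  (alpha - e) * (x - alpha - 3 * e) ^+ 2
    + (x - alpha - 2 * e) * (x - 4 * e) ^+ 2.

Lemma falling3_gt0 (R : realFieldType) (N : R) :
  200 <= N -> 0 < N * (N - 1) * (N - 2).
Proof. by move=> N200; rewrite !mulr_gt0 //; lra. Qed.

(** The lower bound on [a] is used where [a^2] is subtracted, the upper bound in the other two
    places. *)
Lemma le_density_upper (R : realType) (rho alpha N a M : R) :
    0 <= rho -> 17 / 100 <= alpha <= 23 / 100 -> 200 <= N ->
    alpha * N - 1 < a <= alpha * N ->
    67 / 100 * N ^+ 2 <= M <= rho * (N * (N - 1)) + N ->
  (a ^+ 3 + (M - a ^+ 2) * Num.sqrt (M + a ^+ 2)) / (N * (N - 1) * (N - 2))
    <= density_upper rho alpha N^-1.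
Proof.
move=> rho0 /andP[alpha1 alpha2] N200 /andP[a1 a2] /andP[M1 M2].
have N0 : 0 < N by lra.
have Nn0 : N != 0 by rewrite gt_eqF.
have e1 : N^-1 <= 200^-1 by rewrite lef_pV2 // posrE.
rewrite /density_upper.
have -> : N * (N - 1) * (N - 2) = N ^+ 3 * ((1 - N^-1) * (1 - 2 * N^-1)).
  by field.
rewrite invfM mulrA ler_pM2r; last by rewrite invr_gt0 mulr_gt0 //; lra.
rewrite ler_pdivrMr ?exprn_gt0 //; set e := N^-1.
have -> : (alpha ^+ 3 + (rho + e - (alpha - e) ^+ 2)
      * Num.sqrt (rho + e + alpha ^+ 2)) * N ^+ 3 =
    (alpha * N) ^+ 3 + (rho * N ^+ 2 + N - (alpha * N - 1) ^+ 2)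
      * (Num.sqrt (rho + e + alpha ^+ 2) * N).
  by rewrite /e; field.
have -> : Num.sqrt (rho + e + alpha ^+ 2) * N =
    Num.sqrt (rho * N ^+ 2 + N + (alpha * N) ^+ 2).
  rewrite -{1}[N]ger0_norm ?ltW // -sqrtr_sqr mulrC -sqrtrM ?sqr_ge0 //.
  by congr Num.sqrt; rewrite /e; field.
have rN : 0 <= rho * N by rewrite mulr_ge0 // ltW.
have aN1 : 17 / 100 * N <= alpha * N by rewrite ler_pM2r.
have aN2 : alpha * N <= 23 / 100 * N by rewrite ler_pM2r.
move: {e e1} (alpha * N) a1 a2 aN1 aN2 => y a1 a2 y1 y2.
have sq1 : (y - 1) ^+ 2 <= a ^+ 2 by rewrite lerXn2r ?nnegrE //; lra.
have sq2 : a ^+ 2 <= y ^+ 2 by rewrite lerXn2r ?nnegrE //; lra.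
have sq3 : y ^+ 2 <= (23 / 100 * N) ^+ 2 by rewrite lerXn2r ?nnegrE //; lra.
apply: lerD; first by rewrite lerXn2r ?nnegrE //; lra.
apply: ler_pM; [|exact: sqrtr_ge0| |].
- have := sqr_ge0 N; lra.
- lra.
by apply: ler_wsqrtr; lra.
Qed.

Lemma S2_density_le (R : realType) (rho alpha : R) (n : nat)
    (a := Num.truncn (alpha * n%:R)) (m := Num.truncn (rho * 'C(n, 2)%:R))
    (G : sgraph 'I_n) :
    17 / 25 <= rho <= 7 / 10 -> 17 / 100 <= alpha <= 23 / 100 ->
    (200 <= n)%N -> G \in graph_family n m a a ->
  S2_density R G <= density_upper rho alpha n%:R^-1.
Proof.
move=> /andP[rho1 rho2] halpha n200; have /andP[alpha1 alpha2] := halpha.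
have [alpha0 rho0] : 0 <= alpha /\ 0 <= rho by split; lra.
have mb := truncn_bin2_bounds n rho0.
have ab := truncn_mul_bounds alpha0 (ler0n R n).
have := n200; rewrite -(ler_nat R 200) -/a -/m in mb ab *.
set N : R := n%:R in mb ab * => N200.
have [/andP[m1 m2] /andP[a1 a2]] := (mb, ab).
have N0 : 0 < N by lra.
have aN1 : 17 / 100 * N <= alpha * N by rewrite ler_pM2r.
have aN2 : alpha * N <= 23 / 100 * N by rewrite ler_pM2r.
have NN0 : 0 <= N * (N - 1) by rewrite mulr_ge0 //; lra.
have rN1 : 17 / 25 * (N * (N - 1)) <= rho * (N * (N - 1)) by apply: ler_wpM2r.
have rN2 : rho * (N * (N - 1)) <= 7 / 10 * (N * (N - 1)) by apply: ler_wpM2r.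
have N2 : 200 * N <= N ^+ 2 by rewrite expr2 ler_pM2r.
have [M1 M2 M3] : [/\ 67 / 100 * N ^+ 2 <= (2 * m)%:R,
    (2 * m)%:R + N <= 72 / 100 * N ^+ 2 &
    67 / 100 * N ^+ 2 <= (2 * m)%:R + N <= rho * (N * (N - 1)) + N].
  by move: ((2 * m)%:R) m1 m2 => y y1 y2; clear -y1 y2 N200 N2 rN1 rN2;
     rewrite lerD2r y2 andbT; split; lra.
(* At [n = 200] the loss of 1 in the floor is exactly the slack between [17 / 100] and
   [165 / 1000]. *)
have [ha a_gt0 an] : [/\ 165 / 1000 * N <= a%:R <= 23 / 100 * N, (0 < a)%N
    & (a <= n)%N].
  rewrite -(ltr_nat R) -(ler_nat R) -/N; move: (a%:R) a1 a2 => y y1 y2.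
  by clear -y1 y2 aN1 aN2 N200; split; try apply/andP; try split; lra.
rewrite inE => /andP[/eqP cG /existsP[J /and3P[indJ cJ]]].
rewrite leq_min_degree ?card_ord // => /forall_inP degJ.
(* The independent set may be larger than [a]; a subset of size exactly [a] keeps its properties. *)
have [||I /andP[_ IJ] cI] := @exists_between_card _ finset.set0 J a.
- exact: finset.sub0set.
- by rewrite cards0.
have famG : edge_family m #|I| I G.
  rewrite /edge_family cG eqxx cI /=; apply/andP; split.
    by apply/independentP => y z yI zI; move/independentP: indJ;
      apply; apply: (fintype.subsetP IJ).
  by apply/forall_inP => i /(fintype.subsetP IJ); apply: degJ.
have := @sum_sqr_degree_le R _ m I G famG.
rewrite cI card_ord -/N => /(_ a_gt0 ha M1 M2) le_sum.
have le_nb : 2 * (nb_S2 G)%:R <= (sum_sqr_degree G)%:R :> R.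
  rewrite -natrM ler_nat /nb_S2 big_distrr /= leq_sum // => v _.
  by rewrite mul2_bin2 -mulnn leq_mul // leq_pred.
rewrite S2_densityE ?(leq_trans _ n200) // -/N.
apply: le_trans (le_density_upper rho0 halpha N200 ab M3).
rewrite ler_pM2r; first exact: le_trans le_nb le_sum.
by rewrite invr_gt0 falling3_gt0.
Qed.

Lemma density_lower_le (R : realType) (rho alpha N a p : R)
    (x := Num.sqrt (rho + alpha ^+ 2)) :
    17 / 100 <= alpha <= 23 / 100 -> 84 / 100 <= x -> 200 <= N ->
    alpha * N - 1 < a <= alpha * N -> x * N - 2 < p <= x * N - 1 ->
  density_lower rho alpha N^-1 <=
    (a * ((p - a) * (p - a - 1)) + (p - a) * ((p - 1) * (p - 2)))
      / (N * (N - 1) * (N - 2)).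
Proof.
move=> /andP[alpha1 alpha2] x1 N200 /andP[a1 a2] /andP[p1 p2].
have N0 : 0 < N by lra.
have Nn0 : N != 0 by rewrite gt_eqF.
have aN1 : 17 / 100 * N <= alpha * N by rewrite ler_pM2r.
have aN2 : alpha * N <= 23 / 100 * N by rewrite ler_pM2r.
have xN1 : 84 / 100 * N <= x * N by rewrite ler_pM2r.
have N3 := falling3_gt0 N200.
have e : density_lower rho alpha N^-1 * N ^+ 3 =
    (alpha * N - 1) * (x * N - alpha * N - 3) ^+ 2
    + (x * N - alpha * N - 2) * (x * N - 4) ^+ 2.
  by rewrite /density_lower -/x; field.
have lower0 : 0 <= density_lower rho alpha N^-1.
  rewrite -(pmulr_lge0 _ (exprn_gt0 3 N0)) e addr_ge0 //;
    rewrite mulr_ge0 ?sqr_ge0 //; lra.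
have NN : N * (N - 1) * (N - 2) <= N ^+ 3 by have := sqr_ge0 N; nra.
rewrite ler_pdivlMr //; apply: le_trans (ler_wpM2l lower0 NN) _.
rewrite {}e {lower0 NN N3}.
move: (alpha * N) (x * N) a1 a2 p1 p2 aN1 aN2 xN1.
move=> y z a1 a2 p1 p2 aN1 aN2 xN1.
clear N0 Nn0 alpha1 alpha2 x1.
rewrite !expr2; apply: lerD; apply: ler_pM; rewrite ?mulr_ge0 ?ler_pM //; lra.
Qed.

(** The degree sum of [clique_sub] is about [p^2 - a^2], hence about [rho * N^2] by the choice of
    [x]. Keeping [p] below [x * N - 1] leaves room for the [- 2], which covers the floor in the
    number of edges. *)
Lemma clique_sub_size_bounds (R : rcfType) (rho alpha N a p : R)
    (x := Num.sqrt (rho + alpha ^+ 2)) :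
    17 / 25 <= rho <= 7 / 10 -> 17 / 100 <= alpha <= 23 / 100 -> 200 <= N ->
    alpha * N - 1 < a <= alpha * N -> x * N - 2 < p <= x * N - 1 ->
  [/\ 2 * a <= p, 1 <= p, p <= N,
    a * (p - a) + (p - a) * (p - 1) <= rho * (N * (N - 1)) - 2 &
    rho * (N * (N - 1)) <= a * (N - a) + (N - a) * (N - 1)].
Proof.
move=> /andP[rho1 rho2] /andP[alpha1 alpha2] N200 /andP[a1 a2] /andP[p1 p2].
have N0 : 0 < N by lra.
have x0 : 0 <= x by apply: sqrtr_ge0.
have xE : x ^+ 2 = rho + alpha ^+ 2.
  by rewrite sqr_sqrtr // addr_ge0 ?sqr_ge0 //; lra.
have x1 : 84 / 100 <= x by clear -x0 xE rho1 alpha1; nra.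
have x2 : x <= 88 / 100 by clear -x0 xE rho2 alpha1 alpha2; nra.
have xN1 : 84 / 100 * N <= x * N by rewrite ler_pM2r.
have xN2 : x * N <= 88 / 100 * N by rewrite ler_pM2r.
have aN1 : 17 / 100 * N <= alpha * N by rewrite ler_pM2r.
have aN2 : alpha * N <= 23 / 100 * N by rewrite ler_pM2r.
have rN : rho * N <= 7 / 10 * N by rewrite ler_pM2r.
have N2 : 200 * N <= N ^+ 2 by rewrite expr2 ler_pM2r.
have rNN : rho * (N * (N - 1)) <= 7 / 10 * (N * (N - 1)).
  by rewrite ler_wpM2r // mulr_ge0 ?subr_ge0 //; lra.
have xNN : (x * N) ^+ 2 = rho * N ^+ 2 + (alpha * N) ^+ 2.
  by rewrite exprMn xE; ring.
clear xE x0 x1 x2 rho1 rho2 alpha1 alpha2.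
move: (alpha * N) (x * N) a1 a2 p1 p2 aN1 aN2 xN1 xN2 xNN.
move=> y z a1 a2 p1 p2 y1 y2 z1 z2 zE.
have sq : (y - 1) ^+ 2 <= a ^+ 2 by rewrite lerXn2r ?nnegrE //; lra.
have sq2 : a ^+ 2 <= (23 / 100 * N) ^+ 2 by rewrite lerXn2r ?nnegrE //; lra.
have sq3 : p ^+ 2 <= (z - 1) ^+ 2 by rewrite lerXn2r ?nnegrE //; lra.
by split; lra.
Qed.

Lemma S2_density_ge (R : realType) (rho alpha : R) (n : nat)
    (a := Num.truncn (alpha * n%:R)) (m := Num.truncn (rho * 'C(n, 2)%:R)) :
    17 / 25 <= rho <= 7 / 10 -> 17 / 100 <= alpha <= 23 / 100 ->
    (200 <= n)%N ->
  exists2 G, G \in graph_family n m a a &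
    density_lower rho alpha n%:R^-1 <= S2_density R G.
Proof.
move=> hrho halpha n200; have /andP[rho1 rho2] := hrho.
have /andP[alpha1 alpha2] := halpha.
have [alpha0 rho0] : 0 <= alpha /\ 0 <= rho by split; lra.
have mb := truncn_bin2_bounds n rho0.
have ab := truncn_mul_bounds alpha0 (ler0n R n).
have := n200; rewrite -(ler_nat R 200) -/a -/m in mb ab *.
set N : R := n%:R in mb ab * => N200.
pose x := Num.sqrt (rho + alpha ^+ 2).
have x0 : 0 <= x by apply: sqrtr_ge0.
have xE : x ^+ 2 = rho + alpha ^+ 2 by rewrite sqr_sqrtr // addr_ge0 ?sqr_ge0.
have x1 : 84 / 100 <= x by clear -x0 xE rho1 alpha1; nra.
have [p pb] : exists p : nat, x * N - 2 < p%:R <= x * N - 1.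
  have xN1 : 84 / 100 * 200 <= x * N by rewrite ler_pM //; lra.
  have := truncn_mul_bounds x0 (ler0n R n); rewrite -/N.
  case: Num.truncn => [|q] /andP[q1 q2]; first by clear -q1 xN1; exfalso; lra.
  (* [p] is one less than the floor of [x * N]. *)
  exists q; move: q1 q2; rewrite -natr1 => q1 q2; clear -q1 q2.
  by apply/andP; split; lra.
have [a2p p1 pN edges_p edges_n] :=
  clique_sub_size_bounds hrho halpha N200 ab pb.
have p0 : (0 < p)%N by rewrite -(ler_nat R).
have {}a2p : (2 * a <= p)%N by rewrite -(ler_nat R) natrM.
have ap : (a <= p)%N by apply: leq_trans a2p; rewrite leq_pmull.
have pn : (p <= n)%N by rewrite -(ler_nat R).
have natr_pred (q : nat) : (0 < q)%N -> q.-1%:R = q%:R - 1 :> R.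
  by case: q => // q _; rewrite -natr1 addrK.
have [|||G famG nbG] := @exists_dense_graph n a p m _ a2p.
- by rewrite ap.
- rewrite -(ler_nat R) natrD !natrM natrB // natr_pred // -natrM.
  by apply: le_trans edges_p (ltW _); case/andP: mb.
- rewrite -(ler_nat R) natrD !natrM natrB ?(leq_trans ap pn) // natr_pred //.
    by rewrite -natrM; apply: le_trans edges_n; case/andP: mb.
  exact: leq_trans n200.
exists G => //; rewrite S2_densityE ?(leq_trans _ n200) // -/N.
apply: le_trans (density_lower_le halpha x1 N200 ab pb) _.
rewrite ler_pM2r ?invr_gt0 ?falling3_gt0 //.
move: nbG; rewrite -(ler_nat R) natrD !natrM => nbG.
apply: le_trans
  (_ : 2 * (a%:R * 'C(p - a, 2)%:R + (p - a)%:R * 'C(p.-1, 2)%:R) <= _).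
  have -> (y z t : R) : 2 * (a%:R * y + z * t) = a%:R * (2 * y) + z * (2 * t).
    by ring.
  rewrite !bin2_real natrB // natr_pred //.
  by have -> : p%:R - 1 - 1 = p%:R - 2 :> R by ring.
by rewrite ler_pM2l.
Qed.

(** * Limits of the two bounds and the conclusion *)

Local Open Scope classical_set_scope.

Lemma cvg_natrV0 (R : realType) : (n%:R^-1 : R) @[n --> \oo] --> (0 : R).
Proof. by rewrite -cvg_shiftS; exact: cvg_harmonic. Qed.

Lemma cvg_sqr (R : realType) (u : nat -> R) (l : R) :
  u n @[n --> \oo] --> l -> (u n ^+ 2) @[n --> \oo] --> l ^+ 2.
Proof. by move=> ul; under eq_fun do rewrite expr2; exact: cvgM. Qed.

Lemma cvg_affine (R : realType) (c d : R) (u : nat -> R) :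
  u n @[n --> \oo] --> (0 : R) -> (c + d * u n) @[n --> \oo] --> c.
Proof.
move=> u0; rewrite -[X in _ --> X]addr0 -[X in _ + X](mulr0 d).
by apply: cvgD; [exact: cvg_cst|apply: cvgM => //; exact: cvg_cst].
Qed.

Lemma cvg_density_lower (R : realType) (rho alpha : R) : 0 <= rho ->
  density_lower rho alpha n%:R^-1 @[n --> \oo] -->
    alpha ^+ 3 + (rho - alpha ^+ 2) * Num.sqrt (rho + alpha ^+ 2).
Proof.
move=> rho0; have u0 := @cvg_natrV0 R; rewrite /density_lower.
set x := Num.sqrt _; have xE : x ^+ 2 = rho + alpha ^+ 2.
  by rewrite sqr_sqrtr // addr_ge0 ?sqr_ge0.
(* The right side is the value of [density_lower] at [e = 0], with stars centred in the independent
   set and in the rest of the clique. *)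
have -> : alpha ^+ 3 + (rho - alpha ^+ 2) * x =
    alpha * (x - alpha) ^+ 2 + (x - alpha) * x ^+ 2.
  have -> : alpha * (x - alpha) ^+ 2 + (x - alpha) * x ^+ 2 =
    (x ^+ 2 - 2 * alpha ^+ 2) * x + alpha ^+ 3 by ring.
  by rewrite xE; ring.
have cvg c (d : R) : (c - d * n%:R^-1) @[n --> \oo] --> c.
  by under eq_fun do rewrite -mulNr; exact: cvg_affine.
apply: cvgD; apply: cvgM; try exact/cvg_sqr/cvg; last exact: cvg.
by under eq_fun do rewrite -[_^-1]mul1r; exact: cvg.
Qed.

Lemma cvg_density_upper (R : realType) (rho alpha : R) :
  density_upper rho alpha n%:R^-1 @[n --> \oo] -->
    alpha ^+ 3 + (rho - alpha ^+ 2) * Num.sqrt (rho + alpha ^+ 2).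
Proof.
have u0 := @cvg_natrV0 R; rewrite /density_upper.
have cvg_sub c (d : R) : (c - d * n%:R^-1) @[n --> \oo] --> c.
  by under eq_fun do rewrite -mulNr; exact: cvg_affine.
have cvg_sub1 (c : R) : (c - n%:R^-1) @[n --> \oo] --> c.
  by under eq_fun do rewrite -[_^-1]mul1r; exact: cvg_sub.
have cvg_add1 (c : R) : (c + n%:R^-1) @[n --> \oo] --> c.
  by under eq_fun do rewrite -[_^-1]mul1r; exact: cvg_affine.
rewrite -[X in _ --> X]mulr1 -[X in _ * X]invr1 -[X in _ * X^-1]mulr1.
apply: cvgM; last first.
  by apply: cvgV; [rewrite mulr1 oner_neq0|apply: cvgM].
apply: cvgD; first exact: cvg_cst.
apply: cvgM; first by apply: cvgB => //; apply: cvg_sqr.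
apply: continuous_cvg; first exact: sqrt_continuous.
by apply: cvgD => //; exact: cvg_cst.
Qed.

Theorem theorem1p4 (R : realType) (rho alpha : R)
    (hrho : 17 / 25 <= rho <= 7 / 10)
    (halpha : 17 / 100 <= alpha <= 23 / 100) :
  I_S2 rho alpha alpha =
    (alpha ^+ 3 + (rho - alpha ^+ 2) * Num.sqrt (rho + alpha ^+ 2))%:E.
Proof.
set t := _ + _.
(* The upper limit is in fact a limit, obtained by squeezing from [n = 200] on. *)
suff cvg_max : max_S2_density rho alpha alpha @ \oo --> t%:E.
  by rewrite /I_S2 is_cvg_limn_esupE; [exact/cvg_lim|apply/cvg_ex; exists t%:E].
have rho0 : 0 <= rho by case/andP: hrho => h _; apply: le_trans h; lra.
apply: (@squeeze_cvge _ _ _ _ (fun n => (density_lower rho alpha n%:R^-1)%:E)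
  _ (fun n => (density_upper rho alpha n%:R^-1)%:E)).
- exists 200%N => //= n n200; apply/andP; split.
    have [G famG le_G] := S2_density_ge hrho halpha n200.
    by apply: (bigmax_sup G) => //; rewrite lee_fin.
  apply: bigmax_le => [|G famG]; first exact: leNye.
  by rewrite lee_fin S2_density_le.
- by apply: cvg_EFin; [apply: nearW|exact: cvg_density_lower].
by apply: cvg_EFin; [apply: nearW|exact: cvg_density_upper].
Qed.
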